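(* Let $(\Omega,\mathcal{A},P)$ be a probability space, $\mathcal{G}\subset\mathcal{A}$ a sub-$\sigma$-field, $(S,d)$ a separable metric space, $(X_n)_{n\ge 0}$ a sequence of $S$-valued random variables on $(\Omega,\mathcal{A},P)$, $(N_n)_{n\ge 0}$ a sequence of random variables on $(\Omega,\mathcal{A},P)$ with values in $\{0,1,2,\ldots\}$, $(k_n)_{n\ge 0}$ a sequence of strictly positive real constants with $k_n\to\infty$, and $K$ a kernel on $S$. Let $U$ be a strictly positive, $\mathcal{G}$-measurable real random variable. Consider the following conditions: (a* ) $N_n/k_n\to U$ in probability; (b* ) $X_n$ converges $\mathcal{G}$-stably to $K$; (d) $\inf_{\delta>0}\limsup_n P\bigl(M_{N_n}(\delta)>\epsilon\bigr)=0$ for all $\epsilon>0$; (e) $\inf_{\delta>0}\limsup_n P\bigl(M_{[k_nU]}(\delta)>\epsilon\bigr)=0$ for all $\epsilon>0$. Then: (i) If (a* ) holds, then (d) holds if and only if (e) holds. (ii) If (a* ), (b* ) and (d) hold (equivalently, if (a* ), (b* ) and (e) hold), then $X_{N_n}$ converges $\mathcal{G}$-stably to $K$ and $X_{[k_nU]}$ converges $\mathcal{G}$-stably to $K$.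
   Context: A kernel (random probability measure) on $S$ is a map $K$ on $\Omega$ such that $K(\omega)$ is a Borel probability measure on $S$ for each $\omega\in\Omega$, and $\omega\mapsto K(\omega)(B)$ is $\mathcal{A}$-measurable for each Borel set $B\subset S$. For a bounded Borel function $f:S\to\mathbb{R}$, $K(f)$ denotes the real random variable $\omega\mapsto\int f(x)\,K(\omega)(dx)$. A sequence $(Y_n)$ of $S$-valued random variables on $(\Omega,\mathcal{A},P)$ converges $\mathcal{G}$-stably to $K$ if $\lim_n E\{f(Y_n)\mid H\}=E\{K(f)\mid H\}$ for all $H\in\mathcal{G}$ with $P(H)>0$ and all bounded continuous $f:S\to\mathbb{R}$. Here $E\{\cdot\mid H\}$ is the expectation under the conditional probability $P(\cdot\mid H)$ given the event $H$. For an integer $n\ge 0$ and $\delta>0$, let $M_n(\delta)=\max_{j:\,|n-j|\le n\delta} d(X_j,X_n)$, the maximum being over integers $j\ge 0$. For a random index $R$ with values in $\{0,1,2,\ldots\}$, $X_R$ and $M_R(\delta)$ are obtained by evaluating at the random index, i.e. $M_R(\delta)=\max_{j:\,|R-j|\le R\delta} d(X_j,X_R)$; this is applied with $R=N_n$ and $R=[k_nU]$. $[x]$ denotes the integer part of $x$. *)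

(* Defs.v *)
(* MathComp-Analysis *)
From HB Require Import structures.
From mathcomp Require Import all_boot all_order all_algebra.
From mathcomp Require Import all_classical all_reals all_analysis.

Set Implicit Arguments.
Unset Strict Implicit.
Unset Printing Implicit Defensive.

Import Order.TTheory GRing.Theory Num.Theory.
Import numFieldNormedType.Exports.

Local Open Scope classical_set_scope.
Local Open Scope ring_scope.

(* A [measurableType] must be pointed, so the metric space carries a point.
   This only says that it is nonempty, as is any space in which a random
   variable takes its values. *)
#[short(type="pmetricType")]
HB.structure Definition PointedMetric (R : numDomainType) :=
  { S of Metric R S & isPointed S }.

Definition separable (T : topologicalType) : Prop :=
  exists D : set T, countable D /\ dense D.

(* [S] with its Borel sigma-algebra, the one generated by the open sets. *)
Notation borel S := (g_sigma_algebraType (@open S)).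

Section stable_convergence.
Context d (Omega : measurableType d) (R : realType) (P : probability Omega R).

(* The probability [A |-> P (A `&` H) / P H]. The second argument of
   [mnormalize] is only used when [P H = 0]. *)
Definition cond_proba (H : set Omega) (mH : measurable H) :
  probability Omega R := mnormalize (mrestr P mH) P.

Definition cvg_in_proba (Z : nat -> Omega -> R) (Z0 : Omega -> R) : Prop :=
  forall eps : R, 0 < eps ->
    P [set w | eps < `|Z n w - Z0 w|] @[n --> \oo] --> 0%E.

Context (S : pmetricType R).

Definition kernel_integral (K : R.-pker Omega ~> borel S) (f : S -> R) :
  Omega -> R := fun w => Rintegral (K w) setT f.

Definition stable_cvg (G : set (set Omega)) (Y : nat -> Omega -> S)
    (K : R.-pker Omega ~> borel S) : Prop :=
  forall (H : set Omega) (mH : measurable H), G H -> (0 < P H)%E ->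
  forall f : S -> R, continuous f -> bounded_fun f ->
    'E_(cond_proba mH)[f \o Y n]%E @[n --> \oo] -->
    'E_(cond_proba mH)[kernel_integral K f]%E.

(* The integers [j >= 0] with [|n - j| <= n * delta] are all at most
   [n * (1 + delta)], hence the range of the index. They include [n] when
   [0 <= delta] and distances are nonnegative, so that the default value [0]
   does not change the maximum. *)
Definition max_dist (X : nat -> Omega -> S) (delta : R) (n : nat)
    (w : Omega) : R :=
  \big[Num.max/0]_(j < (Num.truncn (n%:R * (1 + delta))).+1
                   | `|n%:R - j%:R| <= n%:R * delta)
    mdist (X j w) (X n w).

Definition random_index_cond (X : nat -> Omega -> S)
    (N : nat -> Omega -> nat) : Prop :=
  forall eps : R, 0 < eps ->
    ereal_inf [set limn_esup
                 (fun n => P [set w | eps < max_dist X delta (N n w) w])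
              | delta in [set delta : R | 0 < delta]] = 0%E.

End stable_convergence.

(* Main.v *)
(* Let [R_n] be random indices with [R_n / k_n -> U] in probability, where
   [0 < U]. Outside an event of small probability [u <= U <= b] with [0 < u], so
   indices that are close to [U] after division by [k_n] are close to [R_n] in
   ratio, and the distance between the corresponding [X]'s is at most
   [max_dist X delta R_n]. This makes (d) and (e) equivalent. For (ii), replace
   [U] by a variable [V] that takes finitely many values on a fine grid: on each
   of the G-measurable events [V = v] the index [k_n V] is a deterministic
   sequence going to infinity, so (b) applies to it, and [X_(k_n V)] is close to
   [X_(R_n)] in probability. This proves convergence for Lipschitz test
   functions. These suffice, as a bounded continuous [f] is the increasing limit
   of the Lipschitz functions [inf_y (f y + m d(x, y))]; applying this to [f] and
   to [- f] bounds the lower and the upper limits. *)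
Require Import Defs.
From mathcomp Require Import all_boot all_order all_algebra.
From mathcomp Require Import all_classical all_reals all_analysis.
From mathcomp Require Import measurable_realfun ring lra.

Set Implicit Arguments.
Unset Strict Implicit.
Unset Printing Implicit Defensive.

Import Order.TTheory GRing.Theory Num.Theory.
Import numFieldNormedType.Exports.

Local Open Scope classical_set_scope.
Local Open Scope ring_scope.

(** * Borel measurability in a separable metric space *)

Section borel_measurability.
Context d (T : measurableType d) (R : realType) (S : pmetricType R).

(* [metric_sym] and [metric_triangle] with the structure of [R] as a
   numDomainType that is inferred from [pmetricType R]; the other path to it
   is convertible but hides the equality of terms from [lra]. *)
Lemma pmetric_sym (x y : S) : mdist x y = mdist y x.
Proof. exact: metric_sym. Qed.

Lemma pmetric_triangle (x y z : S) : mdist x z <= mdist x y + mdist y z.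
Proof. exact: metric_triangle. Qed.

Lemma continuous_measurable_borel (f : S -> R) :
  continuous f -> measurable_fun [set: borel S] f.
Proof.
move=> /continuousP cf.
apply: (@measurability _ _ (borel S) _ setT f _ (RGenInftyO.measurableE R)).
move=> _ [_ [r ->] <-]; rewrite setTI set_itvE.
by apply: sub_sigma_algebra; apply: cf; exact: open_lt.
Qed.

Lemma lipschitz_continuous (f : S -> R) (c : R) : 0 <= c ->
  (forall x y, `|f x - f y| <= c * mdist x y) -> continuous f.
Proof.
move=> c0 fc x; apply/cvgrPdist_lt => e e0; near=> y.
rewrite (le_lt_trans (fc x y))//.
have : mdist x y < e / (c + 1).
  near: y; apply/metricType_numDomainType.nbhs_mdistP; exists (e / (c + 1)) => //=.
  by rewrite divr_gt0// ltr_wpDl.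
rewrite ltr_pdivlMr ?ltr_wpDl// => /(le_lt_trans _); apply.
by rewrite mulrC ler_wpM2l ?mdist_ge0// lerDl.
Unshelve. all: by end_near. Qed.

Lemma mdist_lipschitz (a x y : S) :
  `|mdist x a - mdist y a| <= 1 * mdist x y.
Proof.
rewrite mul1r ler_norml lerNl opprB !lerBlDr; apply/andP; split.
  by rewrite (pmetric_sym x y) pmetric_triangle.
exact: pmetric_triangle.
Qed.

Lemma mdist_continuous (a : S) : continuous (fun x : S => mdist x a).
Proof. exact: (lipschitz_continuous ler01 (mdist_lipschitz a)). Qed.

(** Separability reduces the claim to distances to fixed points: [mdist x y < r] holds exactly when
    [mdist x a + mdist y a < r] for some [a] in a countable dense set, so the preimage of a ray is a
    countable union of measurable sets. *)
Lemma measurable_mdist (X Y : T -> borel S) : separable S ->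
  measurable_fun setT X -> measurable_fun setT Y ->
  measurable_fun setT (fun t => mdist (X t : S) (Y t)).
Proof.
move=> [D [Dc Dd]] mX mY.
have md (a : S) (Z : T -> borel S) : measurable_fun setT Z ->
    measurable_fun setT (fun t => mdist (Z t : S) a).
  apply: (@measurableT_comp _ _ _ _ _ _ (fun x : borel S => mdist (x : S) a)).
  by apply: continuous_measurable_borel; exact: mdist_continuous.
apply: (@measurability _ _ T _ setT _ _ (RGenInftyO.measurableE R)) => _ [_ [r ->] <-].
rewrite setTI.
have -> : (fun t => mdist (X t : S) (Y t)) @^-1` `]-oo, r[%classic =
    \bigcup_(a in D)
      ((fun t => mdist (X t : S) a + mdist (Y t : S) a) @^-1` `]-oo, r[%classic).
  apply/seteqP; split => [t|t [a _]]; rewrite /= !in_itv /=; last first.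
    by apply: le_lt_trans; rewrite (pmetric_sym (Y t)); exact: pmetric_triangle.
  (* Passing through [a] costs at most twice the distance from [a] to [X t], hence half of the
     gap. *)
  move=> tr; set e := (r - mdist (X t : S) (Y t)) / 2.
  have e0 : 0 < e by rewrite divr_gt0// subr_gt0.
  have [||a [/= aX Da]] := Dd [set x : S | mdist x (X t) < e].
  - by exists (X t : S) => /=; rewrite mdistxx.
  - have /continuousP/(_ _ (@open_lt R e)) := @mdist_continuous (X t).
    exact.
  exists a => //=; rewrite in_itv/=.
  have := pmetric_triangle (Y t : S) (X t : S) a.
  rewrite (pmetric_sym (Y t) (X t)).
  move: aX; rewrite (pmetric_sym a) /e; lra.
rewrite bigcup_set_type; apply: countable_bigcupT_measurable.
  by rewrite (eq_countable (card_setT D)).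
move=> a; rewrite -[X in measurable X]setTI.
by apply: measurable_funD => //; exact: md.
Qed.

End borel_measurability.

(** * Evaluation at random indices and the local maximum of distances *)

Section random_index.
Context d (T : measurableType d).

Lemma measurable_fun_random_index d' (T' : measurableType d')
    (F : nat -> T -> T') (N : T -> nat) :
  (forall n, measurable_fun setT (F n)) -> measurable_fun setT N ->
  measurable_fun setT (fun t => F (N t) t).
Proof.
move=> mF mN _ B mB.
have -> : setT `&` (fun t => F (N t) t) @^-1` B =
    \bigcup_n ((N @^-1` [set n]) `&` (F n @^-1` B)).
  by rewrite setTI; apply/seteqP; split => [t BFt|t [n _ [/= <-]]//]; exists (N t).
apply: bigcupT_measurable => n; apply: measurableI.
  by rewrite -[X in measurable X]setTI; exact: mN.
by rewrite -[X in measurable X]setTI; exact: mF.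
Qed.

Context (R : realType) (S : pmetricType R).
Variables (X : nat -> T -> borel S).
Hypothesis separable_S : separable S.
Hypothesis mX : forall n, measurable_fun setT (X n).

Lemma measurable_max_dist (delta : R) (n : nat) :
  measurable_fun setT (max_dist (X : nat -> T -> S) delta n).
Proof.
rewrite /max_dist; elim: (index_enum 'I_(Num.truncn _).+1) => [|j s ih].
  by under eq_fun do rewrite big_nil; exact: measurable_cst.
have [nj|/negbTE nj] := boolP (`|n%:R - j%:R| <= n%:R * delta); last first.
  by under eq_fun do rewrite big_cons nj.
under eq_fun do rewrite big_cons nj.
by apply: measurable_maxr => //; exact: measurable_mdist.
Qed.

Lemma measurable_max_dist_gt (delta eps : R) (N : T -> nat) :
  measurable_fun setT N ->
  measurable [set t | eps < max_dist (X : nat -> T -> S) delta (N t) t].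
Proof.
move=> mN; rewrite -[X in measurable X]setTI.
rewrite (_ : [set t | _] = (fun t => max_dist (X : nat -> T -> S) delta (N t) t)
   @^-1` `]eps, +oo[%classic); last by rewrite set_itvE.
apply: (measurable_fun_random_index (measurable_max_dist delta) mN) => //.
Qed.

Lemma le_max_dist (delta : R) (n j : nat) (t : T) :
  `|n%:R - j%:R| <= n%:R * delta ->
  mdist (X j t : S) (X n t) <= max_dist (X : nat -> T -> S) delta n t.
Proof.
move=> nj.
(* The bounded range of the maximum misses no admissible [j], since [j <= n + n * delta]. *)
have jn : (j < (Num.truncn (n%:R * (1 + delta))).+1)%N.
  rewrite ltnS -(@natrK R j) le_truncn// mulrDr mulr1.
  by move: nj; rewrite distrC => /(le_trans (ler_norm _)); rewrite lerBlDl.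
exact: (@le_bigmax_cond _ _ _ 0 (Ordinal jn)
  (fun j : 'I__ => `|n%:R - j%:R| <= n%:R * delta)
  (fun j => mdist (X j t : S) (X n t))).
Qed.

Lemma max_dist_le (delta e : R) (n : nat) (t : T) : 0 <= e ->
  (forall j, `|n%:R - j%:R| <= n%:R * delta -> mdist (X j t : S) (X n t) <= e) ->
  max_dist (X : nat -> T -> S) delta n t <= e.
Proof. by move=> e0 le_e; apply: bigmax_le => // j; exact: le_e. Qed.

End random_index.

(** * An epsilon-delta form of (d) and (e) *)

Section random_index_condition.
Context d (T : measurableType d) (R : realType) (P : probability T R).
Context (S : pmetricType R).

Lemma random_index_condP (X : nat -> T -> S) (N : nat -> T -> nat) :
  random_index_cond P X N <->
  forall eps : R, 0 < eps -> forall eta : R, 0 < eta ->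
    exists2 delta : R, 0 < delta &
      \forall n \near \oo,
        (P [set w | (eps < max_dist X delta (N n w) w)%R] <= eta%:E)%E.
Proof.
split => [cond eps eps0 eta eta0|cond eps eps0].
  have : (ereal_inf [set limn_esup (fun n =>
      P [set w | (eps < max_dist X delta (N n w) w)%R])
      | delta in [set delta : R | (0 < delta)%R]] < eta%:E)%E.
    by rewrite (cond _ eps0) lte_fin.
  move=> /ereal_inf_lt[_ [delta /= delta0 <-]].
  (* The upper limit is itself an infimum of suprema over neighbourhoods of infinity, so a strict
     upper bound provides one such neighbourhood. *)
  move=> /ereal_inf_lt[_ [V VF <-]] Veta; exists delta => //.
  apply: filterS VF => n Vn; apply/ltW/(le_lt_trans _ Veta).
  by apply: ereal_sup_ubound; exists n.
apply/eqP; rewrite eq_le; apply/andP; split.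
  apply/lee_addgt0Pr => eta eta0; rewrite add0e.
  have [delta delta0 [m _ mP]] := cond _ eps0 _ eta0.
  apply: ge_ereal_inf; exists (limn_esup (fun n =>
      P [set w | (eps < max_dist X delta (N n w) w)%R])).
    by exists delta.
  apply: ge_ereal_inf; exists (ereal_sup ((fun n =>
      P [set w | (eps < max_dist X delta (N n w) w)%R]) @`
      [set n | (m <= n)%N])).
    by exists [set n | (m <= n)%N] => //; exists m.
  by apply: ge_ereal_sup => _ [n /= mn <-]; exact: mP.
apply: le_ereal_inf_tmp => _ [delta _ <-].
exact: limf_esup_ge0.
Qed.

End random_index_condition.

(** * Integrals of bounded functions over sets of finite measure *)

Section bounded_integral.
Context d (T : measurableType d) (R : realType) (mu : {measure set T -> \bar R}).
Variables (H : set T) (c : R).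
Hypotheses (mH : measurable H) (muH : (mu H < +oo)%E).

Lemma bounded_integrable (g : T -> R) :
  measurable_fun setT g -> (forall t, `|g t| <= c) ->
  mu.-integrable H (EFin \o g).
Proof.
move=> mg gc; apply: measurable_bounded_integrable => //.
- exact: measurable_funTS.
- exists c; split; first exact: num_real.
  by move=> x cx t _; exact: le_trans (gc t) (ltW cx).
Qed.

Lemma le_normr_Rintegral_cst (g : T -> R) :
  measurable_fun setT g -> (forall t, `|g t| <= c) ->
  `|\int[mu]_(t in H) g t| <= c * fine (mu H).
Proof.
move=> mg gc; have ig := bounded_integrable mg gc.
rewrite (le_trans (le_normr_Rintegral mH ig))// -Rintegral_cst//.
apply: le_Rintegral => //.
- apply: bounded_integrable => [|t]; last by rewrite normr_id.
  exact: measurableT_comp.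
- apply/integrableP; split; first exact: measurable_cst.
  by rewrite integral_cst// lte_mul_pinfty// lee_fin.
Qed.

Lemma bounded_Rintegral_cvg (g_ : nat -> T -> R) (g : T -> R) :
  (forall n, measurable_fun setT (g_ n)) -> measurable_fun setT g ->
  (forall n t, `|g_ n t| <= c) ->
  (forall t, g_ n t @[n --> \oo] --> g t) ->
  \int[mu]_(t in H) g_ n t @[n --> \oo] --> \int[mu]_(t in H) g t.
Proof.
move=> mg_ mg gc g_g.
have [|||||ig _ h] := @dominated_convergence _ _ _ mu H mH
    (fun n t => (g_ n t)%:E) (fun t => (g t)%:E) (cst c%:E).
- by move=> n; apply/measurable_EFinP; exact: measurable_funTS.
- by apply/measurable_EFinP; exact: measurable_funTS.
- by apply: aeW => t _; apply: cvg_EFin; [exact: nearW|exact: g_g].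
- apply/integrableP; split; first exact: measurable_cst.
  by rewrite integral_cst// lte_mul_pinfty// lee_fin.
- by apply: aeW => t n _; rewrite /= lee_fin.
apply: fine_cvg; rewrite fineK//; exact: integrable_fin_num ig.
Qed.

End bounded_integral.

(** * Conditional expectations as normalized integrals *)

Section conditional_expectation.
Context d (T : measurableType d) (R : realType) (P : probability T R).

Lemma probability_lty (A : set T) : measurable A -> (P A < +oo)%E.
Proof. by move=> mA; rewrite (le_lt_trans (probability_le1 P mA))// ltry. Qed.

(** The conditional probability vanishes off [H] and is a multiple of [P] on the measurable subsets
    of [H]; the integral can therefore be restricted to [H] and the factor taken out. *)
Lemma ge0_integral_cond_proba (H : set T) (mH : measurable H)
    (f : T -> \bar R) : (0 < P H)%E ->
  measurable_fun setT f -> (forall t, 0 <= f t)%E ->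
  (\int[cond_proba P mH]_t f t = (fine (P H))^-1%:E * \int[P]_(t in H) f t)%E.
Proof.
move=> PH0 mf f0.
have PHfin : P H \is a fin_num by exact: fin_num_measure.
have c0 : 0 <= (fine (P H))^-1 by rewrite invr_ge0 fine_ge0.
have condE A : cond_proba P mH A = (P (A `&` H) * (fine (P H))^-1%:E)%E.
  rewrite /cond_proba /= /mnormalize /= /mrestr /= (_ : [set: _] `&` H = H);
    last exact: setTI.
  rewrite (gt_eqF PH0)/=.
  by move: PHfin; rewrite fin_numE => /andP[_ /negbTE ->].
have Q0 : cond_proba P mH (~` H) = 0%E by rewrite condE setICl measure0 mul0e.
rewrite (@ge0_negligible_integral _ _ _ _ setT (~` H)) //; last exact: measurableC.
rewrite setTD setCK -(ge0_integral_mscale P mH (NngNum c0)) //; last first.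
  exact: measurable_funTS.
apply: eq_measure_integral => A mA AH.
by rewrite [LHS]condE (setIidl AH) /mscale/= muleC.
Qed.

Lemma expectation_cond_proba (H : set T) (mH : measurable H) (g : T -> R)
    (c : R) : (0 < P H)%E -> measurable_fun setT g -> (forall t, `|g t| <= c) ->
  ('E_(cond_proba P mH)[g] = ((fine (P H))^-1 * \int[P]_(t in H) g t)%R%:E)%E.
Proof.
move=> PH0 mg gc; rewrite unlock integralE.
have mEg : measurable_fun setT (EFin \o g) by exact/measurable_EFinP.
have ig := bounded_integrable mH (probability_lty mH) mg gc.
rewrite !ge0_integral_cond_proba//;
  [|exact: measurable_funeneg|exact: measurable_funepos].
rewrite -muleBr//; last first.
  by rewrite fin_num_adde_defr// integrable_pos_fin_num.
rewrite EFinM /Rintegral fineK ?integrable_fin_num//.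
by rewrite [in RHS]integralE.
Qed.

End conditional_expectation.

(** * Integration against a kernel *)

Section kernel_integral.
Context d d' (T : measurableType d) (T' : measurableType d') (R : realType).
Variables (K : R.-pker T ~> T').

(** Adding [c] makes the integrand nonnegative, the case in which kernels give measurable integrals;
    as each [K t] has mass 1, the integral only shifts by [c]. *)
Lemma measurable_kernel_Rintegral (f : T' -> R) (c : R) :
  measurable_fun setT f -> (forall x, `|f x| <= c) ->
  measurable_fun setT (fun t => \int[K t]_x f x).
Proof.
move=> mf fc.
have Kfin t : (K t setT < +oo)%E by rewrite prob_kernel ltry.
have -> : (fun t => \int[K t]_x f x) =
    (fun t => \int[K t]_x (f x + c) - c).
  apply/funext => t; rewrite RintegralD//.
  - rewrite Rintegral_cst// prob_kernel/=; ring.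
  - exact: bounded_integrable mf fc.
  - exact: (@bounded_integrable _ _ _ _ _ `|c|).
apply: measurable_funB => //.
apply: measurableT_comp => //.
apply: (@measurable_fun_integral_kernel _ _ _ _ _ K _ (fun x => (f x + c)%:E)).
- by move=> B mB; exact: measurable_kernel.
- move=> x; rewrite lee_fin -lerBlDr sub0r.
  by move: (fc x); rewrite ler_norml => /andP[].
- by apply/measurable_EFinP; exact: measurable_funD.
Qed.

Lemma normr_kernel_Rintegral_le (f : T' -> R) (c : R) (t : T) :
  measurable_fun setT f -> (forall x, `|f x| <= c) ->
  `|\int[K t]_x f x| <= c.
Proof.
move=> mf fc.
have Kfin : (K t setT < +oo)%E by rewrite prob_kernel ltry.
rewrite (le_trans (le_normr_Rintegral_cst measurableT Kfin mf fc))//.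
by rewrite prob_kernel mulr1.
Qed.

End kernel_integral.

(** * Approximation from below by Lipschitz functions *)

Section lipschitz_envelope.
Context (R : realType) (S : pmetricType R) (f : S -> R) (c : R).
Hypothesis fc : forall x, `|f x| <= c.

(* The largest [m]-Lipschitz function below [f]. *)
Definition lip_env (m : nat) (x : S) : R :=
  inf (range (fun y => f y + m%:R * mdist x y)).

Let fge y : - c <= f y.
Proof. by move: (fc y); rewrite ler_norml => /andP[]. Qed.

Let env_lb m x y : lip_env m x <= f y + m%:R * mdist x y.
Proof.
apply: ge_inf; last by exists y.
exists (- c) => _ [z _ <-]; rewrite (le_trans (fge z))// lerDl.
by rewrite mulr_ge0// mdist_ge0.
Qed.

Let env_glb m x b :
  (forall y, b <= f y + m%:R * mdist x y) -> b <= lip_env m x.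
Proof.
move=> bf; apply: lb_le_inf; first by exists (f x + m%:R * mdist x x), x.
by move=> _ [y _ <-].
Qed.

Lemma lip_env_le m x : lip_env m x <= f x.
Proof. by rewrite (le_trans (env_lb m x x))// mdistxx mulr0 addr0. Qed.

Lemma normr_lip_env_le m x : `|lip_env m x| <= c.
Proof.
rewrite ler_norml; apply/andP; split.
  apply: env_glb => y; rewrite (le_trans (fge y))// lerDl.
  by rewrite mulr_ge0// mdist_ge0.
by rewrite (le_trans (lip_env_le m x))// (le_trans (ler_norm _)).
Qed.

Lemma lip_env_lipschitz m x y :
  `|lip_env m x - lip_env m y| <= m%:R * mdist x y.
Proof.
have h a b : lip_env m a - m%:R * mdist a b <= lip_env m b.
  apply: env_glb => z; rewrite lerBlDr (le_trans (env_lb m a z))//.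
  rewrite -addrA lerD2l -mulrDr ler_wpM2l// addrC; exact: pmetric_triangle.
rewrite ler_norml; have := h x y; have := h y x; rewrite (pmetric_sym y x).
by move=> *; apply/andP; split; lra.
Qed.

(** Near [x], continuity keeps [f y] above [f x - e]. At distance at least [r], the penalty [m * r]
    eventually exceeds [2 * c], which bounds the oscillation of [f]. *)
Lemma lip_env_cvg x : {for x, continuous f} ->
  lip_env m x @[m --> \oo] --> f x.
Proof.
move=> cf; apply/cvgrPdist_le => e e0.
have : \forall y \near x, `|f x - f y| <= e by move/cvgrPdist_le : cf; exact.
move=> /metricType_numDomainType.nbhs_mdistP[r /= r0 rf].
near=> m; rewrite ger0_norm ?subr_ge0 ?lip_env_le// lerBlDr -lerBlDl.
apply: env_glb => y; have [xy|rxy] := ltP (mdist x y) r.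
  have := rf _ xy; rewrite ler_norml => /andP[_]; rewrite lerBlDr => fxy.
  rewrite lerBlDl (le_trans fxy)// lerD2l lerDl.
  by rewrite mulr_ge0// mdist_ge0.
have mr : 2 * c <= m%:R * mdist x y.
  apply: (@le_trans _ _ (m%:R * r)); last by rewrite ler_wpM2l.
  rewrite -ler_pdivrMr//; near: m; exact: nbhs_infty_ger.
have := fge y; have := fc x; rewrite ler_norml => /andP[_]; lra.
Unshelve. all: by end_near. Qed.

End lipschitz_envelope.

(** * Stable convergence in terms of integrals over sets of [G] *)

Section stable_convergence.
Context d (T : measurableType d) (R : realType) (P : probability T R).
Context (S : pmetricType R) (K : R.-pker T ~> borel S).

(** Multiplication by [P H] turns conditional expectations into integrals over [H]. Null sets [H]
    may be included because all integrals over them are 0; this lets [H] be cut into pieces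
    freely. *)
Lemma stable_cvgP (G : set (set T)) (Y : nat -> T -> borel S) :
  G `<=` measurable -> (forall n, measurable_fun setT (Y n)) ->
  stable_cvg P G (Y : nat -> T -> S) K <->
  forall H, G H -> forall (f : S -> R) (c : R),
    continuous f -> (forall x, `|f x| <= c) ->
    \int[P]_(t in H) f (Y n t) @[n --> \oo] -->
    \int[P]_(t in H) kernel_integral K f t.
Proof.
move=> GM mY.
have mfY (f : S -> R) n : continuous f -> measurable_fun setT (fun t => f (Y n t)).
  by move=> /continuous_measurable_borel cf; exact: measurableT_comp.
have mKf (f : S -> R) (c : R) : continuous f -> (forall x, `|f x| <= c) ->
    measurable_fun setT (kernel_integral K f).
  move=> /continuous_measurable_borel cf fc.
  exact: measurable_kernel_Rintegral cf fc.
have Kfc (f : S -> R) (c : R) : continuous f -> (forall x, `|f x| <= c) ->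
    forall t, `|kernel_integral K f t| <= c.
  by move=> /continuous_measurable_borel cf fc t; exact: normr_kernel_Rintegral_le.
split => [cvgY H GH f c cf fc|cvgY H mH GH PH0 f cf [M [_ fM]]].
  have mH := GM _ GH.
  have PHfin : P H \is a fin_num by exact: fin_num_measure.
  have [PH0|] := eqVneq (P H) 0%E.
    have int0 (g : T -> R) : measurable_fun setT g -> (forall t, `|g t| <= c) ->
        \int[P]_(t in H) g t = 0.
      move=> mg gc; apply/eqP; rewrite -normr_le0.
      have := le_normr_Rintegral_cst mH (probability_lty P mH) mg gc.
      by rewrite [X in fine X]PH0 mulr0.
    rewrite int0; [|exact: mKf fc|exact: Kfc].
    rewrite (_ : (fun n => _) = cst 0); first exact: cvg_cst.
    by apply/funext => n; apply: int0 => //; exact: mfY.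
  move=> PHn0; have PH0 : (0 < P H)%E by rewrite lt0e PHn0/=.
  have bf : bounded_fun f.
    exists c; split; first exact: num_real.
    by move=> x cx t _; exact: le_trans (fc t) (ltW cx).
  have := cvgY H mH GH PH0 f cf bf.
  rewrite (expectation_cond_proba mH PH0 (mKf _ _ cf fc) (Kfc _ _ cf fc)).
  under eq_fun do
    rewrite (expectation_cond_proba mH PH0 (mfY _ _ cf) (fun t => fc (Y _ t))).
  move=> /fine_cvg/= h.
  have P1 r : r = fine (P H) * ((fine (P H))^-1 * r).
    by rewrite mulrA mulfV ?mul1r// gt_eqF// fine_gt0// PH0 ltey_eq PHfin.
  rewrite (P1 (\int[P]_(t in H) _)).
  have -> : (fun n => \int[P]_(t in H) f (Y n t)) = (fun n => fine (P H) *
      ((fine (P H))^-1 * \int[P]_(t in H) f (Y n t))).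
    by apply/funext => n; exact: P1.
  exact: cvgMr.
(* [bounded_fun] only guarantees the bounds strictly greater than [M]. *)
have fc x : `|f x| <= M + 1 by apply: fM => //; rewrite ltrDl.
rewrite (expectation_cond_proba mH PH0 (mKf _ _ cf fc) (Kfc _ _ cf fc)).
under eq_fun do
  rewrite (expectation_cond_proba mH PH0 (mfY _ _ cf) (fun t => fc (Y _ t))).
apply: cvg_EFin; first exact: nearW.
by apply: cvgMr; exact: cvgY fc.
Qed.

End stable_convergence.

(** * Reduction to Lipschitz test functions *)

Section lipschitz_test_functions.
Context d (T : measurableType d) (R : realType) (P : probability T R).
Context (S : pmetricType R) (K : R.-pker T ~> borel S).
Variables (H : set T) (Y : nat -> T -> borel S).
Hypothesis mH : measurable H.
Hypothesis mY : forall n, measurable_fun setT (Y n).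
Hypothesis cvg_lip : forall (g : S -> R) (L c : R), 0 <= L ->
  (forall x y, `|g x - g y| <= L * mdist x y) -> (forall x, `|g x| <= c) ->
  \int[P]_(t in H) g (Y n t) @[n --> \oo] -->
  \int[P]_(t in H) kernel_integral K g t.

Let PH : (P H < +oo)%E := probability_lty P mH.

Let integrable_comp (f : S -> R) (c : R) (n : nat) :
  continuous f -> (forall x, `|f x| <= c) ->
  P.-integrable H (EFin \o (fun t => f (Y n t))).
Proof.
move=> /continuous_measurable_borel cf fc.
apply: (@bounded_integrable _ _ _ _ _ c) => //; exact: measurableT_comp.
Qed.

(** The integral of [f (Y n)] is at least that of its envelope, whose limit is known for each fixed
    [m]; for large [m] this limit is within [e / 2] of the target. *)
Let lower (f : S -> R) (c e : R) :
  continuous f -> (forall x, `|f x| <= c) -> 0 < e ->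
  \forall n \near \oo,
    \int[P]_(t in H) kernel_integral K f t - e <= \int[P]_(t in H) f (Y n t).
Proof.
move=> cf fc e0.
have e20 : 0 < e / 2 by rewrite divr_gt0.
have cenv m : continuous (lip_env f m).
  exact: lipschitz_continuous (lip_env_lipschitz fc m).
have envc m := normr_lip_env_le fc m.
have mf := continuous_measurable_borel cf.
have menv m := continuous_measurable_borel (cenv m).
(* Dominated convergence is used twice: under [P], and inside under each [K t]. *)
have Kenv : \int[P]_(t in H) kernel_integral K (lip_env f m) t @[m --> \oo] -->
    \int[P]_(t in H) kernel_integral K f t.
  apply: (@bounded_Rintegral_cvg _ _ _ _ _ c) => //.
  - by move=> m; exact: measurable_kernel_Rintegral (menv m) (envc m).
  - exact: measurable_kernel_Rintegral mf fc.
  - by move=> m t; exact: normr_kernel_Rintegral_le (menv m) (envc m).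
  move=> t; apply: (@bounded_Rintegral_cvg _ _ _ _ _ c) => //.
  - by rewrite prob_kernel ltry.
  - by move=> x; apply: lip_env_cvg => //; exact: cf.
have [m _ /(_ m (leqnn m)) /= mK] := (cvgrPdist_le _ _).1 Kenv _ e20.
have /cvgrPdist_le/(_ _ e20) :=
  cvg_lip (ler0n _ m) (lip_env_lipschitz fc m) (envc m).
move=> envY; near=> n.
have : `|\int[P]_(t in H) kernel_integral K (lip_env f m) t -
    \int[P]_(t in H) lip_env f m (Y n t)| <= e / 2 by near: n; exact: envY.
rewrite ler_norml => /andP[_ envYn].
have : \int[P]_(t in H) lip_env f m (Y n t) <= \int[P]_(t in H) f (Y n t).
  apply: le_Rintegral => //.
  - exact: integrable_comp (envc m).
  - exact: integrable_comp fc.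
  - by move=> t _; exact: lip_env_le.
by move: mK; rewrite ler_norml => /andP[_ mK]; lra.
Unshelve. all: by end_near. Qed.

Lemma lipschitz_cvg_Rintegral (f : S -> R) (c : R) :
  continuous f -> (forall x, `|f x| <= c) ->
  \int[P]_(t in H) f (Y n t) @[n --> \oo] -->
  \int[P]_(t in H) kernel_integral K f t.
Proof.
move=> cf fc; apply/cvgrPdist_le => e e0.
(* The upper bound is [lower] for the opposite function, written as a multiple of [f] so that
   scalars come out of the integrals. *)
have cNf : continuous (fun x => -1 * f x).
  by move=> x; apply: cvgMr; exact: cf.
have Nfc x : `|-1 * f x| <= c by rewrite mulN1r normrN.
have mf : measurable_fun [set: borel S] f by exact: continuous_measurable_borel.
have KN : kernel_integral K (fun x => -1 * f x) =
    fun t => -1 * kernel_integral K f t.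
  apply/funext => t; rewrite /kernel_integral RintegralZl//.
  by apply: (bounded_integrable _ _ mf fc) => //; rewrite prob_kernel ltry.
have KfN : \int[P]_(t in H) kernel_integral K (fun x => -1 * f x) t =
    -1 * \int[P]_(t in H) kernel_integral K f t.
  rewrite KN RintegralZl//; apply: (@bounded_integrable _ _ _ _ _ c) => //.
    exact: measurable_kernel_Rintegral mf fc.
  by move=> t; exact: normr_kernel_Rintegral_le mf fc.
near=> n; rewrite distrC ler_norml; apply/andP; split.
  rewrite lerBrDl; near: n; exact: lower cf fc e0.
have : \int[P]_(t in H) kernel_integral K (fun x => -1 * f x) t - e <=
    \int[P]_(t in H) (-1 * f (Y n t)).
  near: n; exact: lower cNf Nfc e0.
rewrite KfN RintegralZl//; last exact: (integrable_comp n cf fc).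
by rewrite !mulN1r; lra.
Unshelve. all: by end_near. Qed.

End lipschitz_test_functions.

(** * Indices whose ratios to [k n] are close to [U] *)

Section random_index_closeness.
Context d (T : measurableType d) (R : realType) (P : probability T R).

Lemma measurable_truncn : measurable_fun [set: R] (Num.truncn : R -> nat).
Proof.
have mlt (r : R) : measurable [set x : R | x < r].
  by rewrite -set_itvNyo; exact: measurable_itv.
move=> _ B _; rewrite setTI (_ : _ @^-1` _ =
    \bigcup_(n in B) [set x : R | Num.truncn x = n]); last first.
  by apply/seteqP; split => [x Bx|x [n Bn /= ->]//]; exists (Num.truncn x).
apply: bigcup_measurable => -[_|n _].
  (* The fibre of 0 also contains all negative numbers, which truncate to 0; the other fibres are
     intervals of length 1. *)
  rewrite (_ : [set x | _] = [set x | x < 1])//.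
  by apply/seteqP; split => x /=; rewrite -(truncn_le_nat x 0) leqn0 => /eqP.
rewrite (_ : [set x | _] = [set x | x < n.+2%:R] `\` [set x | x < n.+1%:R]).
  exact: measurableD.
apply/seteqP; split => x /=; rewrite -!truncn_le_nat.
  by move=> ->; rewrite ltnn.
by move=> [xn /negP]; rewrite -ltnNge => nx; apply/eqP; rewrite eqn_leq xn.
Qed.

(** As [U] is positive and finite, the events [E n] increase to the whole space, and continuity from
    below applies. *)
Lemma tight_gt0 (U : T -> R) : measurable_fun setT U -> (forall t, 0 < U t) ->
  forall eta : R, 0 < eta -> exists u b : R,
    0 < u /\ (P [set t | ~ (u <= U t <= b)%R] <= eta%:E)%E.
Proof.
move=> mU U0 eta eta0.
pose E n := [set t | n.+1%:R^-1 <= U t <= n.+1%:R].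
have mE n : measurable (E n).
  rewrite -[X in measurable X]setTI (_ : E n = U @^-1` `[n.+1%:R^-1, n.+1%:R]%classic).
    exact: mU.
  by apply/seteqP; split => t; rewrite /= in_itv.
have ET : \bigcup_n E n = setT.
  apply/seteqP; split => // t _.
  exists (maxn (Num.truncn (U t)) (Num.truncn (U t)^-1)) => //=.
  apply/andP; split.
    rewrite -[leRHS]invrK lef_pV2 ?posrE ?invr_gt0// ltW//.
    by rewrite (lt_le_trans (truncnS_gt _))// ler_nat ltnS leq_maxr.
  by rewrite ltW// (lt_le_trans (truncnS_gt _))// ler_nat ltnS leq_maxl.
have ndE : nondecreasing_seq E.
  move=> m n mn; apply/subsetPset => t /= /andP[mU1 Um].
  apply/andP; split.
    by apply: le_trans mU1; rewrite lef_pV2 ?posrE// ler_nat ltnS.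
  by rewrite (le_trans Um)// ler_nat ltnS.
have := nondecreasing_cvg_mu (mu := P) mE (bigcupT_measurable _ mE) ndE.
rewrite ET [X in _ --> X](_ : _ = 1%E); last exact: probability_setT.
move=> /fine_cvgP[_ /= /cvgrPdist_le/(_ _ eta0)[n _ /(_ n (leqnn n)) /= hn]].
exists n.+1%:R^-1, n.+1%:R; split; first by rewrite invr_gt0.
rewrite (_ : [set t | _] = ~` E n)//.
rewrite (probability_setC P (mE n)).
have PEn : P (E n) \is a fin_num by exact: fin_num_measure.
rewrite -(fineK PEn) -EFinB lee_fin.
by rewrite (le_trans (ler_norm _) hn).
Qed.

Lemma measurable_ratio_far (N : T -> nat) (U : T -> R) (r g : R) :
  measurable_fun setT N -> measurable_fun setT U ->
  measurable [set t | g < `|(N t)%:R / r - U t|].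
Proof.
move=> mN mU; rewrite -[X in measurable X]setTI (_ : [set t | _] =
    (fun t => `|(N t)%:R / r - U t|) @^-1` `]g, +oo[%classic).
  apply: measurableT_comp => //; apply: measurable_funB => //.
  by apply: (measurableT_comp (f := fun m : nat => m%:R / r)).
by rewrite set_itvoy.
Qed.

(** The exceptional set [B] is where [N n / k n] is farther than [g] from [U], or [U] leaves
    [[u, b]]. Off [B], the ratios of [N n] and [m] to [k n] differ by at most [2 * g] and are both
    at least [u - g], so closeness is relative to either index. The set [B] is chosen before [m], so
    [m] may depend on the sample point. *)
Lemma random_index_close (U : T -> R) (k : nat -> R) (N : nat -> T -> nat)
    (c eta : R) :
  measurable_fun setT U -> (forall t, 0 < U t) ->
  (forall n, 0 < k n) -> (forall n, measurable_fun setT (N n)) ->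
  cvg_in_proba P (fun n t => (N n t)%:R / k n) U ->
  0 < c -> 0 < eta ->
  exists g b : R, 0 < g /\ \forall n \near \oo,
    exists B : set T, [/\ measurable B, (P B <= eta%:E)%E &
      forall t, ~ B t -> U t <= b /\
        forall m : nat, `|m%:R / k n - U t| <= g ->
          `|(N n t)%:R - m%:R| <= (N n t)%:R * c /\
          `|(N n t)%:R - m%:R| <= m%:R * c].
Proof.
move=> mU U0 k0 mN NU c0 eta0.
have eta20 : 0 < eta / 2 by rewrite divr_gt0.
have [u [b [u0 Pub]]] := tight_gt0 mU U0 eta20.
(* This is the solution of [2 * g = c * (u - g)]. *)
pose g := c * u / (2 + c).
have c20 : 0 < 2 + c by rewrite addr_gt0.
have g0 : 0 < g by rewrite divr_gt0// mulr_gt0.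
have cg : 2 * g = c * (u - g) by rewrite /g; field; rewrite gt_eqF.
exists g, b; split => //.
have /fine_cvgP[Pfin /cvgrPdist_le/(_ _ eta20) Psmall] := NU _ g0.
near=> n.
have mA := measurable_ratio_far (k n) g (mN n) mU.
have mC : measurable [set t | ~ (u <= U t <= b)%R].
  have := mU measurableT _ (measurable_itv `[u, b]).
  by rewrite setTI set_itvcc => /measurableC.
exists ([set t | (g < `|(N n t)%:R / k n - U t|)%R] `|`
  [set t | ~ (u <= U t <= b)%R]).
split; first exact: measurableU.
  rewrite (le_trans (measureU2 _ mA mC))// (splitr eta) EFinD leeD//.
  have : `|0 - fine (P [set t | (g < `|(N n t)%:R / k n - U t|)%R])| <= eta / 2.
    by near: n; exact: Psmall.
  rewrite sub0r normrN ger0_norm ?fine_ge0// -lee_fin fineK//.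
  exact: fin_num_measure.
move=> t /not_orP[/negP]; rewrite -leNgt => Ng /contrapT/andP[uU Ub].
split => // m mg.
set x := (N n t)%:R / k n in Ng *; set y := m%:R / k n in mg *.
have xE : (N n t)%:R = x * k n by rewrite mulfVK// gt_eqF.
have yE : m%:R = y * k n by rewrite mulfVK// gt_eqF.
have xy : `|x - y| <= 2 * g.
  rewrite (le_trans (ler_distD (U t) _ _))// mulrDl mul1r lerD//.
  by rewrite distrC.
rewrite xE yE -mulrBl normrM (gtr0_norm (k0 n)) !(mulrAC _ (k n)).
rewrite !ler_pM2r//; split.
  rewrite (le_trans xy)// cg mulrC ler_pM2r// lerBlDr.
  by move: Ng; rewrite ler_norml => /andP[+ _]; lra.
rewrite (le_trans xy)// cg mulrC ler_pM2r// lerBlDr.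
by move: mg; rewrite ler_norml => /andP[+ _]; lra.
Unshelve. all: by end_near. Qed.

End random_index_closeness.

(** * Transfer of the maximum condition between random indices *)

Section random_index_transfer.
Context d (T : measurableType d) (R : realType) (P : probability T R).
Context (S : pmetricType R).
Variables (X : nat -> T -> borel S) (U : T -> R) (k : nat -> R).
Hypotheses (separable_S : separable S) (mX : forall n, measurable_fun setT (X n)).
Hypotheses (mU : measurable_fun setT U) (U_gt0 : forall t, 0 < U t).
Hypothesis k_gt0 : forall n, 0 < k n.

(** Off three events of probability at most [eta / 3], every [j] in the [c]-window of [N n] and
    [N n] itself lie in the [delta]-window of [M n]. So [X j] and [X (N n)] are both within
    [eps / 2] of [X (M n)]. *)
Lemma random_index_cond_transfer (M N : nat -> T -> nat) :
  (forall n, measurable_fun setT (M n)) ->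
  (forall n, measurable_fun setT (N n)) ->
  cvg_in_proba P (fun n t => (M n t)%:R / k n) U ->
  cvg_in_proba P (fun n t => (N n t)%:R / k n) U ->
  random_index_cond P (X : nat -> T -> S) M ->
  random_index_cond P (X : nat -> T -> S) N.
Proof.
move=> mM mN MU NU /random_index_condP condM.
apply/random_index_condP => eps eps0 eta eta0.
have eps20 : 0 < eps / 2 by rewrite divr_gt0.
have eta30 : 0 < eta / 3 by rewrite divr_gt0.
have [delta delta0 Mdelta] := condM _ eps20 _ eta30.
(* From [c <= 1] one gets [N n <= 2 * M n], so the two windows add up to at most
   [M n * c + 2 * M n * c], that is [M n * (3 * c)], which is at most [M n * delta]. *)
pose c := Num.min 1 (delta / 3).
have c0 : 0 < c by rewrite lt_min ltr01 divr_gt0.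
have c1 : c <= 1 by rewrite ge_min lexx.
have cdelta : c * 3 <= delta by rewrite -ler_pdivlMr// ge_min lexx orbT.
have [g [b [g0 closeM]]] := random_index_close mU U_gt0 k_gt0 mM MU c0 eta30.
exists c => //.
have /fine_cvgP[_ /cvgrPdist_le/(_ _ eta30) Nsmall] := NU _ g0.
pose A n := [set t | eps / 2 < max_dist (X : nat -> T -> S) delta (M n t) t].
pose C n := [set t | g < `|(N n t)%:R / k n - U t|].
near=> n.
have [B [mB PB closeB]] : exists B : set T,
    [/\ measurable B, (P B <= (eta / 3)%:E)%E &
      forall t, ~ B t -> U t <= b /\
        forall m : nat, `|m%:R / k n - U t| <= g ->
          `|(M n t)%:R - m%:R| <= (M n t)%:R * c /\
          `|(M n t)%:R - m%:R| <= m%:R * c] by near: n.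
have mA : measurable (A n) by exact: measurable_max_dist_gt.
have mC : measurable (C n) by exact: measurable_ratio_far.
have PA : (P (A n) <= (eta / 3)%:E)%E by near: n.
have PC : (P (C n) <= (eta / 3)%:E)%E.
  have : `|0 - fine (P (C n))| <= eta / 3 by near: n; exact: Nsmall.
  rewrite sub0r normrN ger0_norm ?fine_ge0// -lee_fin fineK//.
  exact: fin_num_measure.
have mABC : measurable (A n `|` (B `|` C n)) by do 2 apply: measurableU => //.
have -> : eta = eta / 3 + (eta / 3 + eta / 3) by field.
rewrite !EFinD; apply: (@le_trans _ _ (P (A n `|` (B `|` C n)))); last first.
  rewrite (le_trans (measureU2 _ mA (measurableU _ _ mB mC)))// leeD//.
  by rewrite (le_trans (measureU2 _ mB mC))// leeD.
apply: le_measure; rewrite ?inE//; first exact: measurable_max_dist_gt.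
move=> t /= epsN; apply: contrapT => /not_orP[/negP nA /not_orP[nB /negP nC]].
move: epsN; apply/negP; rewrite -leNgt.
rewrite -leNgt in nA; rewrite -leNgt in nC.
have [_ /(_ _ nC)[MN _]] := closeB _ nB.
have M0 : 0 <= (M n t)%:R :> R by [].
have NM : (N n t)%:R <= (M n t)%:R * 2 :> R.
  move: MN; rewrite ler_norml => /andP[MN _].
  have : (M n t)%:R * c <= (M n t)%:R by rewrite ler_piMr.
  by move: MN; set u := _ * c; lra.
have dM j : `|(M n t)%:R - j%:R| <= (M n t)%:R * (c * 3) ->
    mdist (X j t : S) (X (M n t) t) <= eps / 2.
  move=> Mj; apply: le_trans nA; apply: le_max_dist.
  by rewrite (le_trans Mj)// ler_wpM2l.
apply: max_dist_le => [|j Nj]; first exact: ltW.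
rewrite (le_trans (pmetric_triangle _ (X (M n t) t) _))// (splitr eps) lerD//.
  apply: dM; rewrite (le_trans (ler_distD (N n t)%:R _ _))//.
  have -> : (M n t)%:R * (c * 3) = (M n t)%:R * c + (M n t)%:R * 2 * c by ring.
  by rewrite lerD// (le_trans Nj)// ler_wpM2r// ltW.
rewrite pmetric_sym; apply: dM; rewrite (le_trans MN)// ler_wpM2l//.
by move: c0; lra.
Unshelve. all: by end_near. Qed.

End random_index_transfer.

(** * Finite sums of limits and splitting of integrals *)

Lemma cvg_sum_ord (R : realType) (u : nat -> nat -> R) (l : nat -> R) (m : nat) :
  (forall i, u i n @[n --> \oo] --> l i) ->
  \sum_(i < m) u i n @[n --> \oo] --> \sum_(i < m) l i.
Proof.
move=> ul; elim: m => [|m ih].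
  rewrite big_ord0 (_ : (fun n => _) = cst 0); first exact: cvg_cst.
  by apply/funext => n; rewrite big_ord0.
rewrite big_ord_recr (_ : (fun n => _) = (fun n => \sum_(i < m) u i n + u m n)).
  by apply: cvgD => //; exact: ul.
by apply/funext => n; rewrite big_ord_recr.
Qed.

Section integral_partition.
Context d (T : measurableType d) (R : realType) (P : probability T R).
Variables (H : set T).
Hypothesis mH : measurable H.

Lemma Rintegral_fibers (J : T -> nat) (m : nat) (F : T -> R) :
  measurable_fun setT J -> (forall t, (J t <= m)%N) ->
  P.-integrable H (EFin \o F) ->
  \int[P]_(t in H) F t =
  \sum_(i < m.+1) \int[P]_(t in H `&` J @^-1` [set (i : nat)]) F t.
Proof.
move=> mJ Jm iF.
have mJB (B : set nat) : measurable (H `&` J @^-1` B).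
  by apply: measurableI => //; rewrite -[X in measurable X]setTI; exact: mJ.
(* The induction runs over the sublevel sets of [J], each step adding one fibre; at [m.+1] the
   sublevel set is everything. *)
suff /(_ m.+1) <- : forall n, \int[P]_(t in H `&` J @^-1` [set j | (j < n)%N]) F t =
    \sum_(i < n) \int[P]_(t in H `&` J @^-1` [set (i : nat)]) F t.
  by rewrite (_ : H `&` _ = H)//; apply/setIidPl => t _ /=; rewrite ltnS.
elim=> [|n ih].
  rewrite big_ord0 (_ : H `&` _ = set0) ?Rintegral_set0//.
  by apply/seteqP; split => [t []|].
rewrite big_ord_recr/= -ih -Rintegral_setU//.
- rewrite -setIUr -preimage_setU; congr (Rintegral _ (_ `&` _ @^-1` _) _).
  apply/seteqP; split => j /=.
    by rewrite ltnS leq_eqVlt => /predU1P[]; [right|left].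
  by move=> [/ltnW|->].
- by apply: (integrableS mH) => //; [exact: measurableU|move=> t [] []].
- by apply/disj_setPS => t [[_ /= Jn] [_ /= JE]]; rewrite JE ltnn in Jn.
Qed.

Lemma le_normr_Rintegral_off (B : set T) (D : T -> R) (a b : R) :
  measurable B -> measurable_fun setT D -> 0 <= a -> 0 <= b ->
  (forall t, `|D t| <= b) -> (forall t, ~ B t -> `|D t| <= a) ->
  `|\int[P]_(t in H) D t| <= a + b * fine (P B).
Proof.
move=> mB mD a0 b0 Db Da.
have iD := bounded_integrable mH (probability_lty P mH) mD Db.
have mHB : measurable (H `&` B) by exact: measurableI.
have mCB : measurable (~` B) by exact: measurableC.
rewrite -(setUIDK H B) Rintegral_setU ?setUIDK//; first last.
- by apply/disj_setPS => t [[_ Bt] [_ nBt]].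
- exact: measurableD.
rewrite addrC (le_trans (ler_normD _ _))// lerD//.
  (* Setting [D] to 0 on [B] makes the bound [a] valid at every point; [P H <= 1] then removes the
     factor [P H]. *)
  rewrite setDE Rintegral_mkcondr.
  rewrite (@le_trans _ _ (a * fine (P H)))//.
    apply: le_normr_Rintegral_cst => //; first exact: probability_lty.
      by apply/(measurable_restrictT _ mCB); exact: measurable_funTS.
    by move=> t; rewrite patchE; case: ifPn => [/set_mem/Da//|_]; rewrite normr0.
  rewrite ler_piMr// -lee_fin fineK ?fin_num_measure//; exact: probability_le1.
rewrite (le_trans (le_normr_Rintegral_cst _ _ mD Db))//; first exact: probability_lty.
rewrite ler_wpM2l// fine_le ?fin_num_measure//.
by apply: le_measure; rewrite ?inE.
Qed.

End integral_partition.

(* For [0 <= u <= b], [grid_point h (grid_index h b u)] is the least multiple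
   of [h] that is greater than [u]; the bound [b] keeps the grid finite. *)
Definition grid_index (R : realType) (h b u : R) : nat :=
  minn (Num.truncn (b / h)) (Num.truncn (u / h)).

Definition grid_point (R : realType) (h : R) (i : nat) : R := h * i.+1%:R.

(** The grid point exceeds [u] by at most [h], and truncation lowers it by less than [r^-1 <= h].
    The two errors have opposite signs, so the total stays within [h]. *)
Lemma grid_point_close (R : realType) (h b u r : R) : 0 < h -> 0 < r ->
  0 <= u -> u <= b -> r^-1 <= h ->
  `|(Num.truncn (r * grid_point h (grid_index h b u)))%:R / r - u| <= h.
Proof.
move=> h0 r0 u0 ub rh; rewrite /grid_point /grid_index (minn_idPr _); last first.
  by rewrite le_truncn// ler_pM2r// invr_gt0.
have /trunc_itv/andP[] : 0 <= u / h by rewrite divr_ge0// ltW.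
set j := Num.truncn (u / h); rewrite ler_pdivlMr// ltr_pdivrMr// => ju uj.
have /trunc_itv/andP[] : 0 <= r * (h * j.+1%:R) by rewrite !mulr_ge0// ltW.
set m := Num.truncn _; rewrite -!natr1 in uj * => mr rm.
have mE : m%:R = m%:R / r * r :> R by rewrite mulfVK// gt_eqF.
have rV1 : 1 = r^-1 * r by rewrite mulVf// gt_eqF.
have {}mr : m%:R / r <= h * (j%:R + 1) by rewrite ler_pdivrMr// mulrC.
have {}rm : h * (j%:R + 1) < m%:R / r + r^-1.
  by rewrite -(ltr_pM2r r0) mulrDl -mE -rV1 mulrC.
by rewrite ler_norml; apply/andP; split; lra.
Qed.

Lemma truncn_ratio_close (R : realType) (r u : R) : 0 < r -> 0 <= u ->
  `|(Num.truncn (r * u))%:R / r - u| <= r^-1.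
Proof.
move=> r0 u0; have /trunc_itv/andP[] : 0 <= r * u by rewrite mulr_ge0// ltW.
set m := Num.truncn _; rewrite -natr1 => mr rm.
have -> : m%:R / r - u = r^-1 * (m%:R - r * u) by field; rewrite gt_eqF.
rewrite normrM gtr0_norm ?invr_gt0//; apply: ler_piMr.
  by rewrite invr_ge0 ltW.
by rewrite ler_norml; apply/andP; split; lra.
Qed.

(** The truncation error is at most [(k n)^-1] at every sample point, so the event is empty for
    large [n]. *)
Lemma cvg_in_proba_truncn d (T : measurableType d) (R : realType)
    (P : probability T R) (U : T -> R) (k : nat -> R) :
  (forall t, 0 < U t) -> (forall n, 0 < k n) -> k n @[n --> \oo] --> +oo ->
  cvg_in_proba P (fun n t => (Num.truncn (k n * U t))%:R / k n) U.
Proof.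
move=> U0 k0 /cvgryPge koo eps eps0; apply: cvg_near_cst; near=> n.
rewrite (_ : [set w | _] = set0) ?measure0//; apply/seteqP; split => // t /=.
apply/negP; rewrite -leNgt.
apply: le_trans (truncn_ratio_close (k0 n) (ltW (U0 t))) _.
by rewrite invf_ple ?posrE//; near: n; exact: koo.
Unshelve. all: by end_near. Qed.

(** * Stable convergence along random indices *)

Section stable_random_index.
Context d (T : measurableType d) (R : realType) (P : probability T R).
Context (S : pmetricType R) (K : R.-pker T ~> borel S).
Variables (G : set (set T)) (X : nat -> T -> borel S) (U : T -> R) (k : nat -> R).
Hypotheses (G_sigma : sigma_algebra setT G) (G_sub : G `<=` measurable).
Hypotheses (separable_S : separable S) (mX : forall n, measurable_fun setT (X n)).
Hypothesis U_meas : forall B : set R, measurable B -> G (U @^-1` B).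
Hypotheses (U_gt0 : forall t, 0 < U t) (k_gt0 : forall n, 0 < k n).
Hypothesis k_infty : k n @[n --> \oo] --> +oo.
Hypothesis stable_X : stable_cvg P G (X : nat -> T -> S) K.

Let mU : measurable_fun setT U.
Proof. by move=> _ B mB; rewrite setTI; apply: G_sub; exact: U_meas. Qed.

Lemma k_truncn_infty (v : R) : 0 < v -> Num.truncn (k n * v) @[n --> \oo] --> \oo.
Proof.
move=> v0; apply/cvgnyPge => m; near=> n.
rewrite truncn_ge_nat; last by rewrite mulr_ge0// ltW.
rewrite -ler_pdivrMr//.
by near: n; move/cvgryPge : k_infty; exact.
Unshelve. all: by end_near. Qed.

Let measurable_grid_index h b : measurable_fun [set: R] (grid_index h b).
Proof.
apply: (@measurableT_comp _ _ _ _ _ _ (fun j => minn (Num.truncn (b / h)) j)) => //.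
apply: measurableT_comp; first exact: measurable_truncn.
exact: measurable_funM.
Qed.

(** On each of the finitely many fibres of the grid index, the random index is a deterministic
    sequence, which tends to infinity because grid points are positive. *)
Lemma stable_grid_index (H : set T) (f : S -> R) (c h b : R) :
  G H -> continuous f -> (forall x, `|f x| <= c) -> 0 < h ->
  \int[P]_(t in H)
    f (X (Num.truncn (k n * grid_point h (grid_index h b (U t)))) t)
      @[n --> \oo] -->
  \int[P]_(t in H) kernel_integral K f t.
Proof.
move=> GH cf fc h0; have mH := G_sub GH.
have mf := continuous_measurable_borel cf.
have := (stable_cvgP P K G_sub mX).1 stable_X.
pose J t := grid_index h b (U t).
have mJ : measurable_fun setT J by exact: measurableT_comp.
have Jb t : (J t <= Num.truncn (b / h))%N by exact: geq_minl.
move=> sX.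
rewrite (Rintegral_fibers mH mJ Jb); last first.
  apply: (@bounded_integrable _ _ _ _ _ c) => //.
  - exact: probability_lty.
  - exact: measurable_kernel_Rintegral mf fc.
  - by move=> t; exact: normr_kernel_Rintegral_le mf fc.
rewrite (_ : (fun n => _) = (fun n => \sum_(i < (Num.truncn (b / h)).+1)
    \int[P]_(t in H `&` J @^-1` [set (i : nat)])
      f (X (Num.truncn (k n * grid_point h i)) t))); last first.
  apply/funext => n; rewrite (Rintegral_fibers mH mJ Jb).
    apply: eq_bigr => i _; apply: eq_Rintegral => t /set_mem[_ /= Jt].
    by rewrite -/(J t) Jt.
  apply: (@bounded_integrable _ _ _ _ _ c) => //.
    exact: probability_lty.
  apply: measurableT_comp => //.
  apply: (@measurable_fun_random_index _ _ _ _
    (fun j => X (Num.truncn (k n * grid_point h j))) J) => //.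
apply: (@cvg_sum_ord _ (fun i n => \int[P]_(t in H `&` J @^-1` [set i])
      f (X (Num.truncn (k n * grid_point h i)) t))
  (fun i => \int[P]_(t in H `&` J @^-1` [set i]) kernel_integral K f t)) => i.
(* Here the measurability of [U] with respect to [G] is essential: stable convergence of [X] is
   applied on this smaller event. *)
have GHJ : G (H `&` J @^-1` [set i]).
  have [_ _ _ GI] := (sigma_algebraP (fun A _ => @subsetT _ A)).1 G_sigma.
  apply: GI => //; apply: (U_meas (B := grid_index h b @^-1` [set i])).
  by rewrite -[X in measurable X]setTI; exact: measurable_grid_index.
apply: (cvg_comp (fun n => Num.truncn (k n * grid_point h i))
  (fun j => \int[P]_(t in H `&` J @^-1` [set i]) f (X j t))).
  by apply: k_truncn_infty; rewrite mulr_gt0.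
exact: sX cf fc.
Qed.

(** For a Lipschitz [f], [X (N n)] is compared with [X (V n)], where [V n] is the index of the grid
    approximation of [U]. Off a small event [V n] lies in the window of [N n], so [le_max_dist]
    bounds the distance of the two. *)
Lemma stable_random_index (N : nat -> T -> nat) :
  (forall n, measurable_fun setT (N n)) ->
  cvg_in_proba P (fun n t => (N n t)%:R / k n) U ->
  random_index_cond P (X : nat -> T -> S) N ->
  stable_cvg P G (fun n t => X (N n t) t : S) K.
Proof.
move=> mN NU /random_index_condP condN.
have mXN n : measurable_fun setT (fun t => X (N n t) t).
  exact: measurable_fun_random_index.
apply/(stable_cvgP P K G_sub mXN) => H GH f0 c0 cf0 f0c0.
apply: (lipschitz_cvg_Rintegral (G_sub GH) mXN _ cf0 f0c0).
move=> {f0 c0 cf0 f0c0} f L c L0 fL fc; apply/cvgrPdist_le => e e0.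
have mH := G_sub GH.
have cf := lipschitz_continuous L0 fL.
have mf := continuous_measurable_borel cf.
have c0 : 0 <= c by exact: le_trans (normr_ge0 _) (fc point).
have L1 : 0 < L + 1 by rewrite ltr_wpDl.
have c1 : 0 < c + 1 by rewrite ltr_wpDl.
(* The error [e] splits into [e / 2] for the convergence along [V], [e / 4] for the Lipschitz bound
   off the bad event, and [e / 4] for the bad event, of probability at most [2 * eta], where the
   difference is at most [2 * c]. Adding 1 keeps the denominators positive. *)
pose eps := e / (4 * (L + 1)); pose eta := e / (16 * (c + 1)).
have eps0 : 0 < eps by rewrite divr_gt0// mulr_gt0.
have eta0 : 0 < eta by rewrite divr_gt0// mulr_gt0.
have Leps : L * eps <= e / 4.
  rewrite (_ : e / 4 = (L + 1) * eps); last by rewrite /eps; field; rewrite gt_eqF.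
  by apply: ler_wpM2r; rewrite ?lerDl// ltW.
have ceta : 2 * c * (eta + eta) <= e / 4.
  rewrite (_ : e / 4 = 2 * (c + 1) * (eta + eta)); last first.
    by rewrite /eta; field; rewrite gt_eqF.
  rewrite ler_wpM2r//; last by rewrite ler_wpM2l// lerDl.
  by rewrite addr_ge0// ltW.
have [delta delta0 Ndelta] := condN _ eps0 _ eta0.
have [g [b [g0 closeN]]] := random_index_close mU U_gt0 k_gt0 mN NU delta0 eta0.
(* The mesh is the tolerance [g], so that [V n / k n] is within [g] of [U] wherever [U <= b] and
   [(k n)^-1 <= g]. *)
pose V n t := Num.truncn (k n * grid_point g (grid_index g b (U t))).
pose A n := [set t | eps < max_dist (X : nat -> T -> S) delta (N n t) t].
have cvgV := stable_grid_index b GH cf fc g0.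
have e20 : 0 < e / 2 by rewrite divr_gt0.
move/cvgrPdist_le : cvgV => /(_ _ e20) cvgV.
near=> n.
have [B [mB PB closeB]] : exists B : set T,
    [/\ measurable B, (P B <= eta%:E)%E &
      forall t, ~ B t -> U t <= b /\
        forall m : nat, `|m%:R / k n - U t| <= g ->
          `|(N n t)%:R - m%:R| <= (N n t)%:R * delta /\
          `|(N n t)%:R - m%:R| <= m%:R * delta] by near: n.
have PA : (P (A n) <= eta%:E)%E by near: n.
have kg : (k n)^-1 <= g.
  rewrite -[leRHS]invrK lef_pV2 ?posrE ?invr_gt0//.
  by near: n; move/cvgryPge : k_infty; exact.
have mA : measurable (A n) by exact: measurable_max_dist_gt.
have mV : measurable_fun setT (V n).
  apply: (@measurableT_comp _ _ _ _ _ _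
    (fun j => Num.truncn (k n * grid_point g j))) => //.
  exact: measurableT_comp.
have mfXV : measurable_fun setT (fun t => f (X (V n t) t)).
  by apply: measurableT_comp => //; exact: measurable_fun_random_index.
have mfXN : measurable_fun setT (fun t => f (X (N n t) t)).
  exact: measurableT_comp.
have fXV t : ~ (A n `|` B) t -> `|f (X (V n t) t) - f (X (N n t) t)| <= L * eps.
  move=> /not_orP[/negP]; rewrite -leNgt => nA nB.
  rewrite (le_trans (fL _ _))// ler_wpM2l//; apply: le_trans nA.
  have [Ub /(_ (V n t))[]] := closeB _ nB; last by move=> NV _; exact: le_max_dist.
  by apply: grid_point_close => //; exact: ltW.
have mAB : measurable (A n `|` B) by exact: measurableU.
have iXV : P.-integrable H (EFin \o (fun t => f (X (V n t) t))).
  by apply: (@bounded_integrable _ _ _ _ _ c) => //; exact: probability_lty.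
have iXN : P.-integrable H (EFin \o (fun t => f (X (N n t) t))).
  by apply: (@bounded_integrable _ _ _ _ _ c) => //; exact: probability_lty.
have fXV2 t : `|f (X (V n t) t) - f (X (N n t) t)| <= 2 * c.
  by rewrite (le_trans (ler_normB _ _))// mulrDl mul1r lerD.
have Leps0 : 0 <= L * eps by rewrite mulr_ge0// ltW.
have c20 : 0 <= 2 * c by rewrite mulr_ge0.
have := le_normr_Rintegral_off P mH mAB (measurable_funB mfXV mfXN) Leps0 c20
  fXV2 fXV.
rewrite RintegralB// => fVN.
have PAB : fine (P (A n `|` B)) <= eta + eta.
  rewrite -lee_fin fineK ?fin_num_measure// EFinD.
  by rewrite (le_trans (measureU2 _ mA mB))// leeD.
have KV : `|\int[P]_(t in H) kernel_integral K f t -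
    \int[P]_(t in H) f (X (V n t) t)| <= e / 2 by near: n; exact: cvgV.
rewrite (le_trans (ler_distD (\int[P]_(t in H) f (X (V n t) t)) _ _))//.
rewrite (splitr e) lerD// (le_trans fVN)//.
rewrite (_ : e / 2 = e / 4 + e / 4); last by field.
by rewrite lerD// (le_trans _ ceta)// ler_wpM2l.
Unshelve. all: by end_near. Qed.

End stable_random_index.

Theorem theorem2 (R : realType) (d : measure_display)
    (Omega : measurableType d) (P : probability Omega R)
    (G : set (set Omega)) (G_sigma : sigma_algebra setT G)
    (G_sub : G `<=` measurable)
    (S : pmetricType R) (S_separable : separable S)
    (X : nat -> {RV P >-> borel S})
    (N : nat -> {RV P >-> nat})
    (k : nat -> R) (k_gt0 : forall n, 0 < k n)
    (k_infty : k n @[n --> \oo] --> +oo)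
    (K : R.-pker Omega ~> borel S)
    (U : Omega -> R) (U_gt0 : forall w, 0 < U w)
    (U_meas : forall B : set R, measurable B -> G (U @^-1` B)) :
  let kU := fun (n : nat) (w : Omega) => Num.truncn (k n * U w) in
  let cond_a := cvg_in_proba P (fun n w => (N n w)%:R / k n) U in
  let cond_b := stable_cvg P G (fun n w => X n w) K in
  let cond_d := random_index_cond P (fun n w => X n w) (fun n w => N n w) in
  let cond_e := random_index_cond P (fun n w => X n w) kU in
  (cond_a -> (cond_d <-> cond_e)) /\
  (cond_a -> cond_b -> cond_d \/ cond_e ->
     stable_cvg P G (fun n w => X (N n w) w) K /\
     stable_cvg P G (fun n w => X (kU n w) w) K).
Proof.
move=> kU cond_a cond_b cond_d cond_e.
have mX n : measurable_fun setT (X n) by exact: measurable_funPT.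
have mN n : measurable_fun setT (N n) by exact: measurable_funPT.
have mU : measurable_fun setT U.
  by move=> _ B mB; rewrite setTI; apply: G_sub; exact: U_meas.
have mkU n : measurable_fun setT (kU n).
  apply: (@measurableT_comp _ _ _ _ _ _ (Num.truncn : R -> nat)).
    exact: measurable_truncn.
  exact: measurable_funM.
(* With this, [kU] meets the same hypothesis as [N]: the transfer can be used in both directions,
   and the convergence result for both indices. *)
have kU_cvg : cvg_in_proba P (fun n w => (kU n w)%:R / k n) U.
  exact: cvg_in_proba_truncn.
have de : cond_a -> cond_d <-> cond_e.
  have tr := random_index_cond_transfer S_separable mX mU U_gt0 k_gt0.
  by move=> a; split; [exact: tr _ _ mN mkU a kU_cvg|exact: tr _ _ mkU mN kU_cvg a].
split=> // a b d_or_e.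
have [D E] : cond_d /\ cond_e by case: d_or_e => h; split=> //; apply/(de a).
have st := stable_random_index G_sigma G_sub S_separable mX U_meas U_gt0 k_gt0.
by split; [exact: st k_infty b _ mN a D|exact: st k_infty b _ mkU kU_cvg E].
Qed.
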